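(* Let $T \subset \mathbb{R}^2$ be a (closed, non-degenerate) equilateral triangle. Then $T$ cannot be tiled by finitely many smaller equilateral triangles, no two of which have two vertices in common. That is, there is no finite collection $T_1, \dots, T_n$ of equilateral triangles, each with side length strictly less than that of $T$, which tiles $T$ and is such that for all $i \neq j$ the triangles $T_i$ and $T_j$ have at most one vertex in common.
   Context: All triangles are closed, non-degenerate solid triangles in the Euclidean plane. A finite collection $T_1, \dots, T_n$ of triangles tiles (or dissects) a triangle $T$ if $T = T_1 \cup \dots \cup T_n$ and the interiors of the $T_i$ are pairwise disjoint. Two triangles have two vertices in common if at least two points of the plane are vertices of both triangles. *)

(* Defs.v *)
From HB Require Import structures.
From mathcomp Require Import all_boot all_order all_algebra.
From mathcomp Require Import all_classical all_reals all_analysis.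

Set Implicit Arguments.
Unset Strict Implicit.
Unset Printing Implicit Defensive.

Import Order.TTheory GRing.Theory Num.Theory.
Import numFieldNormedType.Exports.

Local Open Scope classical_set_scope.
Local Open Scope ring_scope.

(* The library norm on ['rV[R]_2] is the sup norm, so the Euclidean distance is
   defined here; both induce the same topology, hence the same interiors. *)
Definition eucl_dist (R : realType) (p q : 'rV[R]_2) : R :=
  Num.sqrt (\sum_(k < 2) (p 0 k - q 0 k) ^+ 2).

(* A non-degenerate triangle is given by a labelling of its three vertices.
   Two labellings may describe the same region, but a tiling cannot use one
   region twice since the interiors of the tiles are disjoint and non-empty. *)
Record triangle (R : realType) := Triangle {
  vertex : 'I_3 -> 'rV[R]_2;
  vertex_free : free [:: vertex (inord 1) - vertex (inord 0);
                         vertex (inord 2) - vertex (inord 0)]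
}.

Definition vertices (R : realType) (T : triangle R) : set 'rV[R]_2 :=
  range (vertex T).

Definition solid (R : realType) (T : triangle R) : set 'rV[R]_2 :=
  [set p | exists l : 'I_3 -> R,
     [/\ forall i, 0 <= l i, \sum_i l i = 1 & p = \sum_i l i *: vertex T i]].

Definition equilateral (R : realType) (T : triangle R) : Prop :=
  forall i j k l : 'I_3, i != j -> k != l ->
    eucl_dist (vertex T i) (vertex T j) = eucl_dist (vertex T k) (vertex T l).

(* Only meaningful for equilateral triangles, where all sides agree. *)
Definition side_length (R : realType) (T : triangle R) : R :=
  eucl_dist (vertex T (inord 0)) (vertex T (inord 1)).

Definition tiles (R : realType) (n : nat) (t : 'I_n -> triangle R)
    (T : triangle R) : Prop :=
  solid T = \bigcup_i solid (t i) /\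
  forall i j : 'I_n, i != j ->
    interior (solid (t i)) `&` interior (solid (t j)) = set0.

Definition two_common_vertices (R : realType) (T1 T2 : triangle R) : Prop :=
  exists p q : 'rV[R]_2,
    [/\ p != q, (vertices T1 `&` vertices T2) p
              & (vertices T1 `&` vertices T2) q].

(* Main.v *)
Require Import Defs.
From mathcomp Require Import all_boot all_order all_algebra.
From mathcomp Require Import all_classical all_reals all_analysis.
From mathcomp Require Import ring lra zify.

Set Implicit Arguments.
Unset Strict Implicit.
Unset Printing Implicit Defensive.

Import Order.TTheory GRing.Theory Num.Theory.
Import numFieldNormedType.Exports.
Local Open Scope ring_scope.

(** The proof counts corners of tiles. Every tile is described by its three
    corners, a corner being a vertex [q] together with the vector [d] along the
    side to its right, so that the tile has vertices [q], [q + d] and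
    [q + rot60 d]. Two corners at a common vertex are adjacent when the ray to
    the left of the first is the ray to the right of the second. Thus a corner
    has at most one successor and one predecessor for adjacency. For [n] tiles
    there are [N = 3 n] corners; let [p] be the number of those that have a
    predecessor, which is also the number of those that have a successor.

    At a vertex that is not a vertex of the large triangle, the angles leave two
    possibilities: six corners form a full cycle, or three corners fill a
    half-plane whose other side is covered by one tile or lies outside. Hence a
    corner without predecessor starts a chain of three corners
    ([adj_chain]), and two of them have predecessors. Only three corners sit at
    the vertices of the large triangle, so [2 (N - p - 3) <= p].

    Now consider sides of tiles, the side of a corner being the one to its
    right. It runs from the corner [k] to [nxt k], and each of its ends may or
    may not be flush with a tile across it: at [k] this means that [k] has a
    predecessor, at [nxt k] that [nxt k] has a successor. If both ends are
    flush, the two tiles across are distinct, as no two tiles share a side, and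
    both are shorter than the side; the side of the first of them is then flush
    at one end only ([no_adj_prev]). So the number [a2] of doubly flush sides
    satisfies [2 a2 <= p]. At least four sides are flush at no end, namely sides
    of the tiles in the three corners of the large triangle; here one uses that
    a tile is smaller than the large triangle. Counting sides gives
    [N >= 2 p - a2 + 4], whence [2 N >= 3 p + 8], while the first inequality
    says [2 N <= 3 p + 6] ([no_corner_count]).

    The tiles may a priori be rotated against each other, and the local picture
    at a vertex has to be derived from the covering. This is done with germs
    [v + s e + s^2 f] for small [s > 0]: an affine function has a sign on a
    germ, the lexicographic sign of its three coefficients. A germ in the large
    triangle lies in some tile, since there are finitely many tiles, and two
    tiles whose interiors contain one germ coincide. Choosing for [e] the
    direction of a ray and for [f] a direction to its left or right, one finds
    the tile that lies along a given side of the ray ([germ_cases]). All angular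
    comparisons then become comparisons of barycentric coordinates. *)

(** * The sixty-degree rotation and coordinates along a direction *)

Section Plane.
Variable R : realType.
Local Notation V := 'rV[R]_2.
Implicit Types (u v w d e f p : V) (a b c k s : R).

Definition cross u w : R := u 0 0 * w 0 1 - u 0 1 * w 0 0.

Definition rot60 u : V :=
  \row_(k < 2) (if k == 0 then u 0 0 / 2 - Num.sqrt 3 / 2 * u 0 1
                else Num.sqrt 3 / 2 * u 0 0 + u 0 1 / 2).

(** The coordinates of [u] in the basis [d, rot60 d]. *)
Definition al d u : R := cross u (rot60 d) / cross d (rot60 d).
Definition be d u : R := cross d u / cross d (rot60 d).

Lemma rot60_0 u : (rot60 u) 0 0 = u 0 0 / 2 - Num.sqrt 3 / 2 * u 0 1.
Proof. by rewrite mxE. Qed.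

Lemma rot60_1 u : (rot60 u) 0 1 = Num.sqrt 3 / 2 * u 0 0 + u 0 1 / 2.
Proof. by rewrite mxE. Qed.

Lemma sqr_sqrt3 : Num.sqrt 3 * Num.sqrt 3 = 3 :> R.
Proof. by rewrite -expr2 sqr_sqrtr. Qed.

Lemma row2P u w : u 0 0 = w 0 0 -> u 0 1 = w 0 1 -> u = w.
Proof.
move=> h0 h1; apply/rowP => i.
by case: i => -[|[|//]] hi; [move: h0|move: h1];
  congr (u 0 _ = w 0 _); apply: val_inj.
Qed.

Lemma rot60_rot60 u : rot60 (rot60 u) = rot60 u - u.
Proof.
by apply: row2P; rewrite !(mxE, rot60_0, rot60_1) /=; field: sqr_sqrt3.
Qed.

Lemma rot60D u w : rot60 (u + w) = rot60 u + rot60 w.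
Proof. by apply: row2P; rewrite !(mxE, rot60_0, rot60_1) /=; ring. Qed.

Lemma rot60Z k u : rot60 (k *: u) = k *: rot60 u.
Proof. by apply: row2P; rewrite !(mxE, rot60_0, rot60_1) /=; ring. Qed.

Lemma rot60N u : rot60 (- u) = - rot60 u.
Proof. by rewrite -scaleN1r rot60Z scaleN1r. Qed.

Lemma cross_rot60_gt0 d : d != 0 -> 0 < cross d (rot60 d).
Proof.
move=> d0; have s3 : 0 < Num.sqrt 3 :> R by rewrite sqrtr_gt0.
have -> : cross d (rot60 d) = Num.sqrt 3 / 2 * (d 0 0 ^+ 2 + d 0 1 ^+ 2).
  by rewrite /cross rot60_0 rot60_1; ring.
rewrite mulr_gt0 ?divr_gt0 // lt_def addr_ge0 ?sqr_ge0 // andbT.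
apply: contra d0; rewrite paddr_eq0 ?sqr_ge0 // !sqrf_eq0 =>
  /andP[/eqP a /eqP b].
by apply/eqP/row2P; rewrite !mxE.
Qed.

Lemma alD d u w : al d (u + w) = al d u + al d w.
Proof. by rewrite /al /cross !mxE; ring. Qed.

Lemma alZ d k u : al d (k *: u) = k * al d u.
Proof. by rewrite /al /cross !mxE; ring. Qed.

Lemma alN d u : al d (- u) = - al d u.
Proof. by rewrite /al /cross !mxE; ring. Qed.

Lemma beD d u w : be d (u + w) = be d u + be d w.
Proof. by rewrite /be /cross !mxE; ring. Qed.

Lemma beZ d k u : be d (k *: u) = k * be d u.
Proof. by rewrite /be /cross !mxE; ring. Qed.

Lemma beN d u : be d (- u) = - be d u.
Proof. by rewrite /be /cross !mxE; ring. Qed.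

Definition coordE := (alD, alZ, alN, beD, beZ, beN).

Lemma al_id d : d != 0 -> al d d = 1.
Proof. by move=> /cross_rot60_gt0 h; rewrite /al divff ?gt_eqF. Qed.

Lemma be_id d : be d d = 0.
Proof. by rewrite /be /cross; ring. Qed.

Lemma coord_dec d u : d != 0 -> u = al d u *: d + be d u *: rot60 d.
Proof.
move=> /cross_rot60_gt0 h; have {}h := lt0r_neq0 h.
move: h; rewrite /al /be /cross => h.
by apply: row2P; rewrite !(mxE _ (fun _ _ => _ + _)) 
  !(mxE _ (fun _ _ => _ * _)); field.
Qed.

Lemma al_rot60 d u : d != 0 -> al d (rot60 u) = - be d u.
Proof.
move=> d0; rewrite {1}[u](coord_dec _ d0) rot60D !rot60Z rot60_rot60 !coordE.
have -> : al d (rot60 d) = 0 by rewrite /al /cross; ring.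
by rewrite al_id //; ring.
Qed.

Lemma be_rot60 d u : d != 0 -> be d (rot60 u) = al d u + be d u.
Proof.
move=> d0; rewrite {1}[u](coord_dec _ d0) rot60D !rot60Z rot60_rot60 !coordE.
have -> : be d (rot60 d) = 1 by rewrite /be divff // lt0r_neq0 ?cross_rot60_gt0.
by rewrite be_id; ring.
Qed.

Lemma rot60_eq0 d : (rot60 d == 0) = (d == 0).
Proof.
have z : rot60 0 = 0 :> V by rewrite -(scale0r 0) rot60Z !scale0r.
apply/eqP/eqP => [h|->//].
by have := rot60_rot60 d; rewrite h z sub0r => /esym/eqP; rewrite oppr_eq0 =>
  /eqP.
Qed.

End Plane.
(** * Germs of points *)

Section Germs.
Variable R : realType.
Implicit Types (a b c s : R).

(** The sign of [a + s * b + s ^+ 2 * c] for all small [s > 0]. *)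
Definition gpos a b c : Prop :=
  0 < a \/ a = 0 /\ (0 < b \/ b = 0 /\ 0 < c).
Definition gge a b c : Prop :=
  0 < a \/ a = 0 /\ (0 < b \/ b = 0 /\ 0 <= c).

Definition small (P : R -> Prop) : Prop :=
  exists2 s0, 0 < s0 & forall s, 0 < s -> s < s0 -> P s.

Lemma small_and (P Q : R -> Prop) :
  small P -> small Q -> small (fun s => P s /\ Q s).
Proof.
move=> [s1 h1 H1] [s2 h2 H2]; exists (Num.min s1 s2).
  by rewrite lt_min h1.
by move=> s s0; rewrite lt_min => /andP[? ?]; split; [apply: H1|apply: H2].
Qed.

Lemma small_all (n : nat) (P : 'I_n -> R -> Prop) :
  (forall i, small (P i)) -> small (fun s => forall i, P i s).
Proof.
elim: n P => [|n IH] P hP; first by exists 1 => // s _ _ [].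
have [|s1 h1 H1] := IH (fun i => P (lift ord0 i)); first by move=> i; apply: hP.
have [s2 h2 H2] := hP ord0; exists (Num.min s1 s2); first by rewrite lt_min h1.
move=> s s0; rewrite lt_min => /andP[? ?] i.
by case: (unliftP ord0 i) => [j ->|->]; [apply: H1|apply: H2].
Qed.

Lemma small_witness (P : R -> Prop) : small P -> exists s, P s.
Proof. by move=> [s0 h0 H]; exists (s0 / 2); apply: H; lra. Qed.

Lemma small_pos0 a b c : 0 < a -> small (fun s => 0 < a + s * (b + s * c)).
Proof.
move=> a0; set M := `|b| + `|c| + 1.
have M0 : 0 < M by rewrite /M ltr_wpDl ?addr_ge0.
exists (Num.min 1 (a / M)); first by rewrite lt_min ltr01 divr_gt0.
move=> s s0; rewrite lt_min ltr_pdivlMr // => /andP[s1 sM].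
have hb : - `|b| <= b by rewrite lerNl ler_normr lexx orbT.
have hc : - `|c| <= c by rewrite lerNl ler_normr lexx orbT.
have c0 : 0 <= `|c| by [].
have b1 : s * - `|b| <= s * b by rewrite ler_pM2l.
have c1 : s * s * - `|c| <= s * s * c by rewrite ler_pM2l ?mulr_gt0.
have c2 : s * s * `|c| <= s * `|c| by rewrite ler_wpM2r // ger_pMr // ltW.
move: sM; rewrite /M mulrDr mulr1 mulrDr => sM.
rewrite mulrDr mulrA; lra.
Qed.

Lemma gpos_small a b c : gpos a b c -> small (fun s => 0 < a + s * (b + s * c)).
Proof.
case=> [/small_pos0//|[-> [b0|[-> c0]]]].
  have [s0 h0 H] := small_pos0 c 0 b0; exists s0 => // s s1 s2.
  have := H s s1 s2; rewrite mulr0 addr0 add0r => h.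
  by rewrite mulr_gt0.
by exists 1 => // s s1 s2; rewrite !add0r !mulr_gt0.
Qed.

Lemma gge_small a b c : gge a b c -> small (fun s => 0 <= a + s * (b + s * c)).
Proof.
case=> [h|[-> [h|[->]]]].
- have [|s0 h0 H] := @gpos_small a b c; first by left.
  by exists s0 => // s s1 s2; apply/ltW/H.
- have [|s0 h0 H] := @gpos_small 0 b c; first by right; split => //; left.
  by exists s0 => // s s1 s2; apply/ltW/H.
by move=> h; exists 1 => // s s1 s2; rewrite !add0r mulr_ge0 ?mulr_ge0 // ltW.
Qed.

Lemma ggeVgpos a b c : gge a b c \/ gpos (- a) (- b) (- c).
Proof.
rewrite /gge /gpos; case: (ltgtP 0 a) => [?|?|<-]; [by left; left|by right;
  left; lra|].
case: (ltgtP 0 b) => [?|?|<-]; [by left; right; split=> //; left| |].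
  by right; right; split; [lra|left; lra].
case: (lerP 0 c) => ?; first by left; right; split => //; right.
by right; right; split; [lra|right; split; lra].
Qed.

Lemma gpos_ge a b c : gpos a b c -> gge a b c.
Proof. by rewrite /gpos /gge; intuition lra. Qed.

Lemma gge0_ge0 b c : gge 0 b c -> 0 <= b.
Proof. by case=> [|[_ [/ltW|[->]]]]; rewrite ?ltxx. Qed.

End Germs.

(** * Corners of equilateral triangles *)

Section Corners.
Variable R : realType.
Local Notation V := 'rV[R]_2.
Implicit Types (v e f p u : V) (s : R).

(** A counterclockwise equilateral triangle with a distinguished corner: the
    pair [(q, d)] stands for the triangle with vertices [q], [q + d] and
    [q + rot60 d], seen from [q]. *)
Definition corner := (V * V)%type.
Implicit Types C : corner.

Definition turn C : corner := (C.1 + C.2, rot60 C.2 - C.2).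

(** The barycentric coordinates of [p] at the right and left neighbours of the
    distinguished vertex; [fB] vanishes along the right side of the corner. *)
Definition fA C p : R := al C.2 (p - C.1).
Definition fB C p : R := be C.2 (p - C.1).

Definition closed_tri C p : Prop :=
  [/\ 0 <= fA C p, 0 <= fB C p & 0 <= 1 - fA C p - fB C p].
Definition open_tri C p : Prop :=
  [/\ 0 < fA C p, 0 < fB C p & 0 < 1 - fA C p - fB C p].

(** The point [v + s e + s^2 f] lies in the closed, resp. open, triangle for
    all small [s > 0]. *)
Definition germ_in C v e f : Prop :=
  [/\ gge (fA C v) (al C.2 e) (al C.2 f), gge (fB C v) (be C.2 e) (be C.2 f) &
      gge (1 - fA C v - fB C v) (- al C.2 e - be C.2 e)
          (- al C.2 f - be C.2 f)].
Definition germ_open C v e f : Prop :=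
  [/\ gpos (fA C v) (al C.2 e) (al C.2 f), gpos (fB C v) (be C.2 e) (be C.2 f) &
      gpos (1 - fA C v - fB C v) (- al C.2 e - be C.2 e)
           (- al C.2 f - be C.2 f)].

Lemma fAD C p u : fA C (p + u) = fA C p + al C.2 u.
Proof. by rewrite /fA [p + u - _]addrAC (alD _ (p - C.1)). Qed.

Lemma fBD C p u : fB C (p + u) = fB C p + be C.2 u.
Proof. by rewrite /fB [p + u - _]addrAC (beD _ (p - C.1)). Qed.

Lemma fA_vertex C : fA C C.1 = 0.
Proof. by rewrite /fA subrr -(scale0r 0) alZ mul0r. Qed.

Lemma fB_vertex C : fB C C.1 = 0.
Proof. by rewrite /fB subrr -(scale0r 0) beZ mul0r. Qed.

Lemma fAB_eq C p : C.2 != 0 ->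
  p = C.1 + (fA C p *: C.2 + fB C p *: rot60 C.2).
Proof. by move=> d0; rewrite -coord_dec // addrC subrK. Qed.

Lemma turn_neq0 C : C.2 != 0 -> (turn C).2 != 0.
Proof. by rewrite /turn /= -rot60_rot60 !rot60_eq0. Qed.

Lemma al_turn C u : C.2 != 0 -> al (turn C).2 u = be C.2 u.
Proof.
move=> d0; rewrite {2}[u](coord_dec _ (turn_neq0 d0)) /turn /=.
by rewrite rot60D rot60N rot60_rot60 !coordE be_rot60 // be_id al_id //; ring.
Qed.

Lemma be_turn C u : C.2 != 0 -> be (turn C).2 u = - al C.2 u - be C.2 u.
Proof.
move=> d0; rewrite {2 3}[u](coord_dec _ (turn_neq0 d0)) /turn /=.
by rewrite rot60D rot60N rot60_rot60 !coordE be_rot60 // al_rot60 // be_id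
  al_id //; ring.
Qed.

Lemma fA_turn C p : C.2 != 0 -> fA (turn C) p = fB C p.
Proof.
move=> d0; rewrite /fA al_turn // /fB [(turn C).1]/= opprD addrA !coordE.
by rewrite be_id subr0.
Qed.

Lemma fB_turn C p : C.2 != 0 -> fB (turn C) p = 1 - fA C p - fB C p.
Proof.
move=> d0; rewrite /fB be_turn // /fA [(turn C).1]/= opprD addrA !coordE.
by rewrite be_id al_id //; ring.
Qed.

Lemma turn3 C : turn (turn (turn C)) = C.
Proof.
case: C => q d; rewrite /turn /= !(rot60D, rot60N, rot60_rot60).
by move: (rot60 d) => r; congr pair; apply: row2P; rewrite !mxE; ring.
Qed.

Lemma closed_turn C p : C.2 != 0 -> closed_tri (turn C) p <-> closed_tri C p.
Proof.
move=> d0; rewrite /closed_tri fA_turn // fB_turn //.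
by split=> -[? ? ?]; split=> //; lra.
Qed.

Lemma open_turn C p : C.2 != 0 -> open_tri (turn C) p <-> open_tri C p.
Proof.
move=> d0; rewrite /open_tri fA_turn // fB_turn //.
by split=> -[? ? ?]; split=> //; lra.
Qed.

Definition germ v e f s : V := v + s *: (e + s *: f).

Lemma fA_germ C v e f s :
  fA C (germ v e f s) = fA C v + s * (al C.2 e + s * al C.2 f).
Proof. by rewrite fAD !coordE. Qed.

Lemma fB_germ C v e f s :
  fB C (germ v e f s) = fB C v + s * (be C.2 e + s * be C.2 f).
Proof. by rewrite fBD !coordE. Qed.

Lemma germ_open_small C v e f :
  germ_open C v e f -> small (fun s => open_tri C (germ v e f s)).
Proof.
case=> /gpos_small hA /gpos_small hB /gpos_small hG.
have [s0 h0 H] := small_and (small_and hA hB) hG; exists s0 => // s s1 s2.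
have [[a b] c] := H s s1 s2.
by split; rewrite ?fA_germ ?fB_germ //; move: c; congr (_ < _); ring.
Qed.

Lemma germ_in_small C v e f :
  germ_in C v e f -> small (fun s => closed_tri C (germ v e f s)).
Proof.
case=> /gge_small hA /gge_small hB /gge_small hG.
have [s0 h0 H] := small_and (small_and hA hB) hG; exists s0 => // s s1 s2.
have [[a b] c] := H s s1 s2.
by split; rewrite ?fA_germ ?fB_germ //; move: c; congr (_ <= _); ring.
Qed.

Lemma germ_out_small C v e f :
  ~ germ_in C v e f -> small (fun s => ~ closed_tri C (germ v e f s)).
Proof.
move=> nin.
have [hA|/gpos_small[s0 h0 H]] := ggeVgpos (fA C v) (al C.2 e) (al C.2 f);
  last first.
  by exists s0 => // s s1 s2 [+ _ _]; rewrite fA_germ; have := H s s1 s2; lra.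
have [hB|/gpos_small[s0 h0 H]] := ggeVgpos (fB C v) (be C.2 e) (be C.2 f);
  last first.
  by exists s0 => // s s1 s2 [_ + _]; rewrite fB_germ; have := H s s1 s2; lra.
have [hG|/gpos_small[s0 h0 H]] := ggeVgpos (1 - fA C v - fB C v)
  (- al C.2 e - be C.2 e) (- al C.2 f - be C.2 f); first by case: nin.
exists s0 => // s s1 s2 [_ _]; rewrite fA_germ fB_germ.
by have := H s s1 s2; lra.
Qed.

Definition along_side C v e f : Prop :=
  [/\ fB C v = 0, be C.2 e = 0, 0 <= be C.2 f, gge (fA C v) (al C.2 e) 0 &
      gge (1 - fA C v) (- al C.2 e) 0].

(** A germ is either given by a ray going into the interior, whatever [f] is, or
    runs along one of the three sides. *)
Lemma germ_in_cases C v e f : C.2 != 0 -> germ_in C v e f ->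
  (forall g, germ_open C v e g) \/
  [\/ along_side C v e f, along_side (turn C) v e f
    | along_side (turn (turn C)) v e f].
Proof.
move=> d0; have d1 := turn_neq0 d0.
rewrite /along_side (al_turn e d1) (be_turn e d1) (be_turn f d1) (fA_turn v d1).
rewrite (fB_turn v d1) !(al_turn _ d0) !(be_turn _ d0) !(fA_turn _ d0).
rewrite !(fB_turn _ d0) /germ_in /germ_open /gge /gpos => -[hA hB hG].
case: hA => [hA|[hA [hA1|[hA1 hA2]]]]; case: hB => [hB|[hB [hB1|[hB1 hB2]]]];
case: hG => [hG|[hG [hG1|[hG1 hG2]]]];
by [ left=> g; split; intuition lra
   | right; constructor 1; split; intuition lra
   | right; constructor 2; split; intuition lra
   | right; constructor 3; split; intuition lra].
Qed.

End Corners.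

(** * Counting corners *)

Section Counting.
Variables (K : finType) (adj : K -> K -> Prop) (nxt : K -> K).
Variables (top : 'I_3 -> K) (z : K).
Hypothesis nxt_inj : injective nxt.
Hypothesis adj_injl : forall k k' k2, adj k k2 -> adj k' k2 -> k = k'.
Hypothesis adj_injr : forall k k' k2, adj k k' -> adj k k2 -> k' = k2.
Hypothesis chain : forall k, k \notin codom top -> ~ (exists k', adj k' k) ->
  exists k1 k2, adj k k1 /\ adj k1 k2.
Hypothesis noprev : forall k b g k',
  adj (nxt b) k -> adj (nxt k) k' -> adj g b -> False.
Hypothesis top_inj : injective top.
Hypothesis z_top : z \notin codom top.
Hypothesis free_side : forall k, k \in z :: codom top ->
  ~ (exists k', adj k' k) /\ ~ (exists k', adj (nxt k) k').

(** Call the side from [k] to [nxt k] flush at [k] if [k] has a predecessor, and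
    flush at [nxt k] if [nxt k] has a successor. The sides of [top j] and of [z]
    are flush at no end. Each side flush at both ends yields, injectively, one
    that is flush at its second end only: the side ending at the predecessor. *)
Lemma no_corner_count : False.
Proof.
pose succ k := odflt k [pick k' | `[< adj k k' >]].
pose pred k := odflt k [pick k' | `[< adj k' k >]].
pose Rs := [set k | `[< exists k', adj k' k >]].
pose L := [set k | `[< exists k', adj k k' >]].
have succP k : k \in L -> adj k (succ k).
  rewrite inE => /asboolP[k' hk]; rewrite /succ; case: pickP => [? /asboolP//|].
  by move=> /(_ k')/asboolP.
have predP k : k \in Rs -> adj (pred k) k.
  rewrite inE => /asboolP[k' hk]; rewrite /pred; case: pickP => [? /asboolP//|].
  by move=> /(_ k')/asboolP.
have LI k k' : adj k k' -> k \in L by move=> h; rewrite inE; apply/asboolP;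
  exists k'.
have RI k k' : adj k' k -> k \in Rs by move=> h; rewrite inE; apply/asboolP;
  exists k'.
have succ_inj : {in L &, injective succ}.
  by move=> k k' /succP h /succP h' e; rewrite e in h; apply: adj_injl h h'.
have pred_inj : {in Rs &, injective pred}.
  by move=> k k' /predP h /predP h' e; rewrite e in h; apply: adj_injr h h'.
have cLR : #|L| = #|Rs|.
  rewrite -(card_in_imset succ_inj); congr #|pred_of_set _|; apply/setP => k.
  apply/imsetP/idP => [[k' /succP h ->]|/predP h]; first exact: RI h.
  by exists (pred k); rewrite ?(LI _ _ h) //;
    apply: adj_injr h (succP _ (LI _ _ h)).
pose S := [set top j | j : 'I_3].
have cS : #|S| = 3%N by rewrite card_imset // card_ord.
have inS k : (k \in S) = (k \in codom top).
  by apply/imsetP/codomP => [[j _ ->]|[j ->]]; exists j.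
pose L' := nxt @^-1: L.
have cL' : #|L'| = #|L| by apply: card_preimset.
pose U := ~: Rs :\: S.
have cU : (2 * #|U| <= #|Rs|)%N.
  have hU k : k \in U -> adj k (succ k) /\ adj (succ k) (succ (succ k)).
    rewrite !inE inS => /andP[/chain h /asboolPn/h[k1 [k2 [h1 h2]]]].
    have E : k1 = succ k by apply: adj_injr h1 (succP _ (LI _ _ h1)).
    by rewrite -E; split=> //; apply: succP (LI _ _ h2).
  have i1 : {in U &, injective succ}.
    by move=> k k' /hU[h _] /hU[h' _]; apply: succ_inj;
      [apply: LI h|apply: LI h'].
  have i2 : {in U &, injective (succ \o succ)}.
    move=> k k' hk hk' /= /succ_inj e; apply: i1 => //; apply: e.
      exact: LI (hU _ hk).2.
    exact: LI (hU _ hk').2.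
  have dis : [disjoint succ @: U & (succ \o succ) @: U].
    apply/pred0P => k /=; apply/negP => /andP[/imsetP[a ha ->] /imsetP[b hb /=
      e]].
    have ab : a = succ b.
      by apply: succ_inj e; [apply: LI (hU _ ha).1|apply: LI (hU _ hb).2].
    move: ha; rewrite ab !inE => /andP[_ /asboolPn]; apply.
    by exists b; case: (hU _ hb).
  have /subset_leq_card : (succ @: U :|: (succ \o succ) @: U) \subset Rs.
    apply/fintype.subsetP => k; rewrite inE => /orP[] /imsetP[a /hU[h1 h2] ->].
      exact: RI h1.
    exact: RI h2.
  by rewrite cardsU disjoint_setI0 // cards0 subn0 !card_in_imset // addnn
    mul2n.
have cA : (#|Rs :&: L'| <= #|L' :\: Rs|)%N.
  pose f k := invF nxt_inj (pred k).
  have fi : {in Rs :&: L' &, injective f}.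
    move=> k k'; rewrite inE => /andP[h _]; rewrite inE => /andP[h' _].
    by move=> /(can_inj (f_invF nxt_inj)) e; apply: pred_inj.
  rewrite -(card_in_imset fi); apply/subset_leq_card/fintype.subsetP =>
    b /imsetP[k].
  rewrite finset.in_setI [k \in L']inE => /andP[/predP h1 /succP h2] ->.
  have nf : nxt (f k) = pred k by rewrite /f f_invF.
  rewrite !inE nf; apply/andP; split; last by apply/asboolP; exists k.
  apply/asboolPn => -[g hg]; apply: (noprev _ h2 hg); rewrite nf; exact: h1.
have c0 : (4 <= #|~: (Rs :|: L')|)%N.
  have <- : #|z |: S| = 4%N by rewrite cardsU1 inS z_top cS.
  apply/subset_leq_card/fintype.subsetP => k; rewrite !inE => hk.
  have [] := free_side (k := k).
    by rewrite inE -inS; exact: hk.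
  by move=> n1 n2; rewrite negb_or; apply/andP; split; apply/asboolPn.
have h1 := cardsC (Rs :|: L'); have h2 := cardsC Rs.
have h3 := cardsU Rs L'; have h4 := cardsID Rs L'; rewrite finset.setIC in h4.
have h5 : (#|~: Rs| <= #|U| + 3)%N.
  by rewrite -cS -(cardsID S (~: Rs)) addnC leq_add2l subset_leq_card //
    finset.subsetIr.
have h6 : (#|Rs :&: L'| <= #|Rs|)%N by rewrite subset_leq_card //
  finset.subsetIl.
lia.
Qed.

End Counting.

(** * Corners of a tiling around a common vertex *)

Section Tiling.
Variables (R : realType) (n : nat) (c : 'I_n -> corner R) (T : corner R).
Local Notation V := 'rV[R]_2.
Implicit Types (v e f p u : V) (s x y : R) (i : 'I_n) (j : 'I_3).

Definition cor (k : 'I_n * 'I_3) : corner R := iter k.2 (@turn R) (c k.1).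
Definition nxt (k : 'I_n * 'I_3) : 'I_n * 'I_3 := (k.1, k.2 + 1).
Definition vtx k : V := (cor k).1.
Definition dir k : V := (cor k).2.
Definition Tc j : corner R := iter j (@turn R) T.

Local Notation K := ('I_n * 'I_3)%type.
Implicit Types (k : K).

Hypothesis T_neq0 : T.2 != 0.
Hypothesis c_neq0 : forall i, (c i).2 != 0.
Hypothesis cover : forall p, closed_tri T p <-> exists i, closed_tri (c i) p.
Hypothesis disj : forall i i' p,
  open_tri (c i) p -> open_tri (c i') p -> i = i'.
Hypothesis smaller : forall k x, dir k = x *: T.2 -> x < 1.
Hypothesis no_shared_side : forall k k', k.1 != k'.1 ->
  vtx k = vtx (nxt k') -> vtx (nxt k) = vtx k' -> False.

Lemma iter_turn_neq0 (C : corner R) m : C.2 != 0 -> (iter m (@turn R) C).2 != 0.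
Proof. by elim: m => //= m IH /IH/turn_neq0. Qed.

Lemma dir_neq0 k : dir k != 0.
Proof. exact: iter_turn_neq0. Qed.

Lemma Tc_neq0 j : (Tc j).2 != 0.
Proof. exact: iter_turn_neq0. Qed.

Lemma cor_nxt k : cor (nxt k) = turn (cor k).
Proof. by case: k => i [[|[|[|//]]] h]; rewrite /cor //= turn3. Qed.

Lemma Tc_succ j : Tc (j + 1) = turn (Tc j).
Proof. by case: j => [[|[|[|//]]] h]; rewrite /Tc //= turn3. Qed.

Lemma vtx_nxt k : vtx (nxt k) = vtx k + dir k.
Proof. by rewrite /vtx cor_nxt. Qed.

Lemma dir_nxt k : dir (nxt k) = rot60 (dir k) - dir k.
Proof. by rewrite /dir cor_nxt. Qed.

Lemma ord3_cases j j' : [\/ j' = j, j' = j + 1 | j' = j + 1 + 1].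
Proof.
by case: j => [[|[|[|//]]] h]; case: j' => [[|[|[|//]]] h'];
  (constructor 1; exact: val_inj) || (constructor 2; exact: val_inj)
  || (constructor 3; exact: val_inj).
Qed.

Lemma same_tile k k' : k.1 = k'.1 -> [\/ k' = k, k' = nxt k | k' = nxt (nxt k)].
Proof.
case: k k' => [i j] [i' j'] /= <-.
by have [->|->|->] := ord3_cases j j';
  [constructor 1|constructor 2|constructor 3].
Qed.

Lemma nxtK k : nxt (nxt (nxt k)) = k.
Proof.
by case: k => i [[|[|[|//]]] h]; congr pair; apply: val_inj.
Qed.

Lemma closed_iter (C : corner R) m p : C.2 != 0 ->
  closed_tri (iter m (@turn R) C) p <-> closed_tri C p.
Proof.
by move=> d0; elim: m => //= m IH; rewrite closed_turn ?iter_turn_neq0.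
Qed.

Lemma open_iter (C : corner R) m p : C.2 != 0 ->
  open_tri (iter m (@turn R) C) p <-> open_tri C p.
Proof.
by move=> d0; elim: m => //= m IH; rewrite open_turn ?iter_turn_neq0.
Qed.

(** Every overlap argument below is this one, for a well-chosen germ. *)
Lemma overlap k k' v e f :
  germ_open (cor k) v e f -> germ_open (cor k') v e f -> k.1 = k'.1.
Proof.
move=> /germ_open_small h /germ_open_small h'.
have [s [a b]] := small_witness (small_and h h').
by apply: (disj (p := germ v e f s)); [move: a|move: b]; rewrite open_iter.
Qed.

Lemma sub_T k v e f : germ_in (cor k) v e f -> forall j,
  gge (fB (Tc j) v) (be (Tc j).2 e) (be (Tc j).2 f).
Proof.
move=> /germ_in_small h j.
case: (ggeVgpos (fB (Tc j) v) (be (Tc j).2 e) (be (Tc j).2 f)) => //.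
move=> /gpos_small h'; have [s [a b]] := small_witness (small_and h h').
have : closed_tri (Tc j) (germ v e f s).
  by rewrite closed_iter // cover; exists k.1; move: a; rewrite closed_iter.
by case=> _; rewrite fB_germ; lra.
Qed.

(** Finitely many closed tiles that all miss the germ miss it for a common range
    of parameters, which the covering forbids when the germ lies in the large
    triangle. *)
Lemma germ_cases v e f :
  [\/ exists j, gpos (- fB (Tc j) v) (- be (Tc j).2 e) (- be (Tc j).2 f),
      exists k, forall g, germ_open (cor k) v e g
    | exists k, along_side (cor k) v e f].
Proof.
case: (pselect (germ_in T v e f)) => [hT|nT]; last first.
  constructor 1; case: (pselect (exists j,
    gpos (- fB (Tc j) v) (- be (Tc j).2 e) (- be (Tc j).2 f))) => // nj.
  have all j : gge (fB (Tc j) v) (be (Tc j).2 e) (be (Tc j).2 f).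
    case: (ggeVgpos (fB (Tc j) v) (be (Tc j).2 e) (be (Tc j).2 f)) => // h.
    by case: nj; exists j.
  case: nT; have := all 0; have := all (0 + 1); have := all (0 + 1 + 1).
  have E : Tc 0 = T by [].
  rewrite !Tc_succ E !fB_turn ?turn_neq0 // !fA_turn //.
  rewrite !be_turn ?turn_neq0 // !al_turn // => hA hG hB.
  split=> //; last first.
  by move: hA; congr gge; ring.
suff [i hi] : exists i, germ_in (c i) v e f.
  have [h|[h|h|h]] := germ_in_cases (c_neq0 i) hi.
  - by constructor 2; exists (i, 0).
  - by constructor 3; exists (i, 0).
  - by constructor 3; exists (nxt (i, 0)); rewrite cor_nxt.
  - by constructor 3; exists (nxt (nxt (i, 0))); rewrite !cor_nxt.
case: (pselect (exists i, germ_in (c i) v e f)) => // ni.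
have out i : small (fun s => ~ closed_tri (c i) (germ v e f s)).
  by apply: germ_out_small => hi; apply: ni; exists i.
have [s [a b]] := small_witness (small_and (germ_in_small hT) (small_all out)).
by have [i /b] := (cover _).1 a.
Qed.

Lemma germ_open_turn (C : corner R) v e f : C.2 != 0 ->
  germ_open (turn C) v e f <-> germ_open C v e f.
Proof.
move=> d0; rewrite /germ_open !fA_turn // !fB_turn // !al_turn // !be_turn //.
have E a b : 1 - b - (1 - a - b) = a :> R by ring.
have E' a b : - b - (- a - b) = a :> R by ring.
by rewrite E !E'; split=> -[].
Qed.

Lemma germ_open_same k k' v e f : k.1 = k'.1 ->
  germ_open (cor k) v e f <-> germ_open (cor k') v e f.
Proof.
by case/same_tile => ->; rewrite // !cor_nxt !germ_open_turn ?turn_neq0 //;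
  exact: dir_neq0.
Qed.

Definition on_side k v : Prop :=
  [/\ fB (cor k) v = 0, 0 < fA (cor k) v & 0 < 1 - fA (cor k) v].

(** Only the directions of the two sides along the common ray agree; their
    lengths need not. *)
Definition adj k k' : Prop :=
  vtx k = vtx k' /\ exists2 x, 0 < x & dir k' = x *: rot60 (dir k).

(** Near [v], the half-plane to the right of [d] is covered by a single tile or
    lies outside the tiled triangle. *)
Definition blocked v d : Prop :=
  (exists j, [/\ fB (Tc j) v = 0, be (Tc j).2 d = 0 & 0 < be (Tc j).2 (rot60
    d)])
  \/ (exists k, [/\ on_side k v, be (dir k) d = 0 & be (dir k) (rot60 d) < 0]).

Lemma germ_own k : germ_open (cor k) (vtx k) (dir k) (rot60 (dir k)).
Proof.
have d0 := dir_neq0 k.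
rewrite /germ_open -/(vtx k) -/(dir k) fA_vertex fB_vertex.
rewrite al_rot60 // be_rot60 // be_id al_id //.
by rewrite /gpos; split; intuition lra.
Qed.

Lemma germ_own_left k : germ_open (cor k) (vtx k) (rot60 (dir k)) (dir k).
Proof.
have d0 := dir_neq0 k.
rewrite /germ_open -/(vtx k) -/(dir k) fA_vertex fB_vertex.
rewrite al_rot60 // be_rot60 // be_id al_id //.
by rewrite /gpos; split; intuition lra.
Qed.

Lemma germ_open_in (C : corner R) v e f :
  germ_open C v e f -> germ_in C v e f.
Proof. by case=> /gpos_ge ? /gpos_ge ? /gpos_ge ?; split. Qed.

Lemma be_eq0 (d e : V) : d != 0 -> be d e = 0 -> e = al d e *: d.
Proof. by move=> d0 h; rewrite {1}[e](coord_dec _ d0) h scale0r addr0. Qed.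

(** The germs used run along the right side of [k], slightly outside its tile:
    no tile contains this ray in its interior, as it would overlap that of
    [k]. *)
Lemma right_ray k : blocked (vtx k) (dir k) \/ exists k', adj k' k.
Proof.
have d0 := dir_neq0 k.
have [[j hj]|[k' hk]|[k' [hB hBe hBf hA hG]]] :=
  germ_cases (vtx k) (dir k) (- rot60 (dir k)).
- have := sub_T (germ_open_in (germ_own k)) j; move: hj.
  rewrite beN /gge /gpos => h1 h2; left; left; exists j.
  by split; intuition lra.
- have tt := overlap (hk (rot60 (dir k))) (germ_own k).
  have [_ + _] := (germ_open_same _ _ _ tt).1 (hk (- rot60 (dir k))).
  rewrite -/(dir k) fB_vertex be_id beN be_rot60 // be_id al_id //.
  by rewrite /gpos; clear tt; intuition lra.
have d0' := dir_neq0 k'; move: hB hBe hBf hA hG; rewrite -/(dir k') => hB hBe.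
rewrite beN be_rot60 // hBe addr0; set x := al _ _ => hx hA hG.
have e_eq : dir k = x *: dir k' by exact: be_eq0.
have x0 : x < 0.
  rewrite lt_def -oppr_ge0 hx andbT eq_sym; apply: contra d0 => /eqP x0.
  by rewrite e_eq x0 scale0r.
have A0 : 0 < fA (cor k') (vtx k) by move: hA; rewrite /gge; intuition lra.
case: hG => [hG|[hG _]].
  left; right; exists k'; split=> //.
  by rewrite be_rot60 // hBe addr0.
right; exists (nxt k'); split.
  have A1 : fA (cor k') (vtx k) = 1 by lra.
  by rewrite vtx_nxt [RHS](fAB_eq _ d0') hB A1 scale0r addr0 scale1r.
exists (- x); first by lra.
by rewrite dir_nxt rot60D rot60N rot60_rot60 addrAC subrr sub0r scaleNr scalerN
  opprK.
Qed.

Lemma left_ray k (e := rot60 (dir k)) :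
  [\/ exists j, [/\ fB (Tc j) (vtx k) = 0, be (Tc j).2 e = 0
                  & be (Tc j).2 (rot60 e) < 0],
      exists k', [/\ on_side k' (vtx k), be (dir k') e = 0
                   & 0 < be (dir k') (rot60 e)]
    | exists k', adj k k'].
Proof.
have d0 := dir_neq0 k; have e0 : e != 0 by rewrite rot60_eq0.
have [[j hj]|[k' hk]|[k' [hB hBe hBf hA hG]]] :=
  germ_cases (vtx k) e (rot60 e).
- have := sub_T (germ_open_in (germ_own_left k)) j; move: hj.
  rewrite -/e /gge /gpos => h1 h2; constructor 1; exists j.
  by split; intuition lra.
- have tt := overlap (hk (dir k)) (germ_own_left k).
  have [+ _ _] := (germ_open_same _ _ _ tt).1 (hk (- dir k)).
  rewrite -/(dir k) fA_vertex alN al_id // al_rot60 // be_id.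
  by rewrite /gpos; clear tt; intuition lra.
have d0' := dir_neq0 k'; move: hB hBe hBf hA hG; rewrite -/(dir k') => hB hBe.
rewrite be_rot60 // hBe addr0; set x := al _ _ => hx hA hG.
have e_eq : e = x *: dir k' by exact: be_eq0.
have x0 : 0 < x.
  rewrite lt_def hx andbT; apply: contra e0 => /eqP x0.
  by rewrite e_eq x0 scale0r.
have G0 : 0 < 1 - fA (cor k') (vtx k) by move: hG; rewrite /gge; intuition lra.
case: hA => [hA|[hA _]].
  constructor 2; exists k'; split=> //.
  by rewrite be_rot60 // hBe addr0.
constructor 3; exists k'; split.
  by rewrite [LHS](fAB_eq _ d0') hB hA !scale0r !addr0.
exists x^-1; first by rewrite invr_gt0.
by rewrite -/e e_eq scalerA mulVf ?scale1r // gt_eqF.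
Qed.

Definition Tvertex v : Prop := exists j, v = (Tc j).1.

Lemma two_T_sides j j' v : j != j' ->
  fB (Tc j) v = 0 -> fB (Tc j') v = 0 -> Tvertex v.
Proof.
have d0 := Tc_neq0 j; move=> jj' hB hB'.
have [E|E|E] := ord3_cases j j'; first by rewrite E eqxx in jj'.
  exists (j + 1); move: hB'; rewrite E !Tc_succ fB_turn // hB subr0 => hA.
  have A1 : fA (Tc j) v = 1 by lra.
  by rewrite [LHS](fAB_eq _ d0) hB A1 scale0r addr0 scale1r.
exists j; move: hB'; rewrite E !Tc_succ fB_turn ?turn_neq0 // fA_turn //.
rewrite fB_turn // hB => hA; have A0 : fA (Tc j) v = 0 by lra.
by rewrite [LHS](fAB_eq _ d0) hB A0 !scale0r !addr0.
Qed.

Lemma on_side_germ k v d : on_side k v -> be (dir k) d = 0 ->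
  germ_in (cor k) v d 0.
Proof.
case=> hB hA hG hd; rewrite /germ_in -/(dir k) hB hd -[0 : V](scale0r 0)
  !coordE.
by rewrite /gge subr0; split; [left|intuition lra|left].
Qed.

(** A line carrying a segment of the large triangle around [v] cannot cross a
    side of that triangle at [v]. *)
Lemma on_side_T k v d j : on_side k v -> be (dir k) d = 0 ->
  fB (Tc j) v = 0 -> be (Tc j).2 d = 0.
Proof.
move=> hv hd h0; have hd' : be (dir k) (- d) = 0 by rewrite beN hd oppr0.
have := sub_T (on_side_germ hv hd) j; have := sub_T (on_side_germ hv hd') j.
by rewrite h0 beN /gge; intuition lra.
Qed.

Lemma on_side_vtx k k' : k.1 = k'.1 -> ~ on_side k (vtx k').
Proof.
have d0 := dir_neq0 k; case/same_tile => ->; rewrite /on_side.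
- by rewrite fA_vertex => -[_]; rewrite ltxx.
- rewrite vtx_nxt fAD fA_vertex al_id // => -[_ _]; lra.
rewrite !vtx_nxt dir_nxt !fBD -/(dir k) fB_vertex beD beN be_id be_rot60 //.
by rewrite al_id // be_id => -[]; lra.
Qed.

Lemma on_side_uniq k k' v : k.1 = k'.1 -> on_side k v -> on_side k' v -> k = k'.
Proof.
have d0 := dir_neq0 k => tt [hB hA hG] [hB' _ _]; move: hB'.
case/same_tile: tt => -> //; rewrite !cor_nxt.
  by rewrite fB_turn // hB => h; exfalso; lra.
by rewrite fB_turn ?turn_neq0 // fA_turn // fB_turn // hB => h; exfalso; lra.
Qed.

(** If the directions [d] and [e] at [v] span an angle less than pi, the
    half-planes to the right of [d] and to the left of [e] overlap, so the
    latter cannot be covered by a single tile (or by the outside) once the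
    former is. *)
Lemma blocked_adj k d x y : rot60 (dir k) = x *: d + y *: rot60 d -> 0 < y ->
  ~ Tvertex (vtx k) -> blocked (vtx k) d -> exists k', adj k k'.
Proof.
set v := vtx k; set e := rot60 (dir k) => he y0 nT hbl.
have beE w : be w e = x * be w d + y * be w (rot60 d) by rewrite he !coordE.
have beE' w : be w (rot60 e) = x * be w (rot60 d) + y * (be w (rot60 d) - be w
  d).
  by rewrite he rot60D !rot60Z rot60_rot60 !coordE.
move: (left_ray k); rewrite -/v -/e.
move=> h; case: h => [[j [jB je jf]]|[k' [k's k'e k'f]]|//]; exfalso;
  clearbody v e.
  rewrite beE in je; rewrite beE' in jf.
  case: hbl => [[j' [j'B j'd j'f]]|[k' [k's k'd k'f]]].
    case: (eqVneq j j') => [E|/two_T_sides]; last by move=> /(_ _ jB j'B).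
    by move: je; rewrite E j'd mulr0 add0r => /eqP; rewrite mulf_eq0 !gt_eqF.
  have jd := on_side_T k's k'd jB; rewrite jd in je jf.
  have jr : be (Tc j).2 (rot60 d) = 0.
    by apply/eqP; move: je => /eqP; rewrite mulr0 add0r mulf_eq0 gt_eqF.
  by move: jf; rewrite jr subr0 !mulr0 addr0 ltxx.
case: hbl => [[j [jB jd jf]]|[k2 [k2s k2d k2f]]].
  have := on_side_T k's k'e jB; rewrite beE jd; nra.
have neg (p r : R) : x * p + y * r = 0 -> 0 < x * r + y * (r - p) -> p < 0.
  move=> e1 e2; have : 0 < y * (x * r + y * (r - p)) by rewrite mulr_gt0.
  have -> : y * (x * r + y * (r - p)) = (x + y) * (y * r) - y * y * p by ring.
  have -> : y * r = - (x * p) by lra.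
  have -> : (x + y) * - (x * p) - y * y * p = - (x * x + x * y + y * y) * p.
    by ring.
  rewrite mulNr oppr_gt0 pmulr_rlt0 //.
  have -> : x * x + x * y + y * y = (x + y / 2) ^+ 2 + 3 / 4 * (y * y) by field.
  by rewrite ltr_wpDl ?sqr_ge0 // !mulr_gt0.
have p0 : be (dir k') d < 0.
  by apply: (neg _ (be (dir k') (rot60 d))); rewrite -?beE -?beE'.
(* [- d - e] points into both half-planes *)
pose w := - d - e.
have g1 : germ_open (cor k') v w 0.
  have [h1 h2 h3] := k's; rewrite /germ_open -/(dir k') h1 /w !coordE k'e.
  by rewrite /gpos; split; intuition lra.
have g2 : germ_open (cor k2) v w 0.
  have [h1 h2 h3] := k2s; rewrite /germ_open -/(dir k2) h1 /w !coordE k2d beE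
    k2d.
  rewrite /gpos; split; [by left| |by left; lra].
  by right; split => //; left; nra.
have E := on_side_uniq (overlap g1 g2) k's k2s.
by move: p0; rewrite E k2d ltxx.
Qed.

(** The half-plane to the right of a corner without predecessor is blocked, so
    the corner has a successor, and this one, whose left ray is still at an
    angle less than pi, has a successor as well. *)
Lemma adj_chain k : ~ Tvertex (vtx k) -> ~ (exists k', adj k' k) ->
  exists k1 k2, adj k k1 /\ adj k1 k2.
Proof.
move=> nT nr; have [hbl|//] := right_ray k.
have [||k1 h1] := @blocked_adj k (dir k) 0 1 _ _ nT hbl => //.
  by rewrite scale0r add0r scale1r.
have [v1 [x x0 d1]] := h1.
have [|||k2 h2] := @blocked_adj k1 (dir k) (- x) x _ x0; rewrite -?v1 //.
  by rewrite d1 rot60Z rot60_rot60 scalerBr addrC scaleNr.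
by exists k1, k2.
Qed.

Lemma vtx_inj k k' : k.1 = k'.1 -> vtx k = vtx k' -> k = k'.
Proof.
have d0 := dir_neq0 k => tt; case/same_tile: tt => -> //.
  rewrite vtx_nxt => /esym/eqP; rewrite -subr_eq0 addrAC subrr add0r.
  by rewrite (negPf d0).
rewrite !vtx_nxt dir_nxt -addrA [dir k + _]addrC subrK.
move=> /esym/eqP; rewrite -subr_eq0 addrAC subrr add0r.
by rewrite rot60_eq0 (negPf d0).
Qed.

Lemma same_ray k k' x : vtx k = vtx k' -> 0 < x -> dir k' = x *: dir k ->
  k = k'.
Proof.
move=> hv x0 hd; apply: vtx_inj => //.
apply: (overlap (germ_own k)); rewrite hv.
have d0 := dir_neq0 k'; have -> : dir k = x^-1 *: dir k'.
  by rewrite hd scalerA mulVf ?scale1r ?gt_eqF.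
have ix : 0 < x^-1 by rewrite invr_gt0.
rewrite /germ_open -/(dir k') -/(vtx k') fA_vertex fB_vertex rot60Z !coordE.
rewrite be_id al_id // al_rot60 // be_rot60 // be_id al_id //.
by rewrite /gpos; split; intuition lra.
Qed.

Lemma adj_injr k k' k2 : adj k k' -> adj k k2 -> k' = k2.
Proof.
move=> [v1 [x x0 d1]] [v2 [y y0 d2]].
apply: (@same_ray _ _ (y / x)); rewrite -?v1 ?divr_gt0 //.
by rewrite d1 d2 scalerA divfK ?gt_eqF.
Qed.

Lemma rot60_inj (d e : V) : rot60 d = rot60 e -> d = e.
Proof.
move=> h; apply/eqP; rewrite -subr_eq0 -rot60_eq0 rot60D rot60N h subrr //.
Qed.

Lemma adj_injl k k' k2 : adj k k2 -> adj k' k2 -> k = k'.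
Proof.
move=> [v1 [x x0 d1]] [v2 [y y0 d2]].
apply: (@same_ray _ _ (x / y)); rewrite ?v1 ?divr_gt0 //.
apply: rot60_inj; rewrite rot60Z mulrC -scalerA -d1 d2 scalerA mulVf ?gt_eqF //.
by rewrite scale1r.
Qed.

(** The sides of [k] and [b] lie on one line, their tiles on either side of it,
    and they share the vertex of [k]. They do not have the same length, or the
    two tiles would share two vertices. If the side of [b] were longer, its tile
    would overlap that of [k'] at the far end of the side of [k]. If it is
    shorter, [b] lies strictly inside the side of [k], and a predecessor [g] of
    [b] would have to lie in the tile of [k]. *)
Lemma no_adj_prev k b g k' :
  adj (nxt b) k -> adj (nxt k) k' -> adj g b -> False.
Proof.
move=> [va [x x0 da]] [vc [y y0 dc]] [vg [z z0 dg]].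
have b0 := dir_neq0 b; have k0 := dir_neq0 k; have g0 := dir_neq0 g.
have k'0 := dir_neq0 k'.
have {}da : dir k = - x *: dir b.
  by rewrite da dir_nxt rot60D rot60N rot60_rot60 addrAC subrr sub0r scalerN
    scaleNr.
have {}dc : dir k' = - y *: dir k.
  by rewrite dc dir_nxt rot60D rot60N rot60_rot60 addrAC subrr sub0r scalerN
    scaleNr.
have vb : vtx b = vtx k + x^-1 *: dir k.
  by rewrite -va vtx_nxt da scalerA mulrN mulVf ?gt_eqF // scaleN1r addrK.
have ix : 0 < x^-1 by rewrite invr_gt0.
have xx : x * x^-1 = 1 by rewrite divff ?gt_eqF.
have nt : k.1 != b.1.
  apply/eqP => tt.
  have E : nxt b = k by apply: vtx_inj.
  clear tt.
  move: da; rewrite -{}E dir_nxt => /(congr1 (be (dir b))).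
  by rewrite !coordE be_rot60 // be_id al_id //; lra.
have bE : be (dir k) (dir b) = 0 by apply/eqP; have := be_id (dir k);
  rewrite {2}da beZ => /eqP; rewrite mulf_eq0 oppr_eq0 (gt_eqF x0).
have aE : al (dir k) (dir b) = - x^-1.
  by have := al_id k0; rewrite {2}da alZ => h; nra.
have bE' : be (dir b) (dir k) = 0 by rewrite da beZ be_id mulr0.
have aE' : al (dir b) (dir k) = - x by rewrite da alZ al_id // mulr1.
(* [x^-1] is the quotient of the lengths of the sides of [b] and [k] *)
case: (ltgtP x^-1 1) => x1; last first.
- apply: (no_shared_side nt) => //.
  by rewrite vtx_nxt vb x1 scale1r.
- have vk' : vtx k' = vtx b + (1 - x^-1) *: dir k.
    by rewrite -vc vtx_nxt vb -addrA -scalerDl [_ + (1 - _)]addrC subrK scale1r.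
  have x2 : x < 1 by nra.
  have sb : on_side b (vtx k').
    rewrite /on_side vk' fAD fBD fA_vertex fB_vertex -/(dir b) !coordE bE' aE'.
    by split; nra.
  apply: (on_side_vtx _ sb).
  apply: (@overlap _ _ (vtx k') (- dir k) (- rot60 (dir k))).
    have [h1 h2 h3] := sb; rewrite /germ_open -/(dir b) h1 !coordE bE'.
    rewrite be_rot60 // bE' aE' /gpos; split; [by left| |by left; lra].
    by right; split=> //; right; split; lra.
  have iy : 0 < y^-1 by rewrite invr_gt0.
  have -> : dir k = - y^-1 *: dir k'.
    by rewrite dc scalerA mulrNN mulVf ?gt_eqF // scale1r.
  rewrite /germ_open -/(dir k') -/(vtx k') fA_vertex fB_vertex rot60Z !coordE.
  rewrite al_rot60 // be_rot60 // be_id al_id //.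
  by rewrite /gpos; split; intuition lra.
- have sk : on_side k (vtx g).
    rewrite /on_side vg vb fAD fBD fA_vertex fB_vertex -/(dir k) !coordE al_id
      //.
    by rewrite be_id; split; lra.
  apply: (on_side_vtx _ sk).
  apply: (@overlap _ _ (vtx g) (rot60 (dir g)) (dir g)); last first.
    exact: germ_own_left.
  have [h1 h2 h3] := sk.
  have e1 := bE; have e2 := aE; move: e1 e2; rewrite dg beZ alZ be_rot60 //.
  rewrite al_rot60 // => e1 e2.
  have p0 : 0 < be (dir k) (dir g) by nra.
  have e3 : al (dir k) (dir g) + be (dir k) (dir g) = 0 by nra.
  rewrite /germ_open -/(dir k) h1 be_rot60 // e3 /gpos.
  by split; [by left| |by left; lra]; right; split=> //; right; split.
Qed.

Lemma sub_TA k v e f j : germ_in (cor k) v e f ->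
  gge (fA (Tc j) v) (al (Tc j).2 e) (al (Tc j).2 f).
Proof.
have d0 := Tc_neq0 j; have d1 := turn_neq0 d0.
move=> /sub_T/(_ (j + 1 + 1)); rewrite !Tc_succ (fB_turn _ d1) (fA_turn _ d0).
rewrite (fB_turn _ d0) !(be_turn _ d1) !(al_turn _ d0) !(be_turn _ d0).
by congr gge; ring.
Qed.

(** The large triangle leaves only sixty degrees at its own vertices, just
    enough for one corner. *)
Lemma T_corner_dir k j : vtx k = (Tc j).1 ->
  exists2 x, 0 < x & dir k = x *: (Tc j).2.
Proof.
move=> hv; have d0 := Tc_neq0 j.
have gr := germ_open_in (germ_own k); have gl := germ_open_in (germ_own_left k).
have := sub_T gr j; have := sub_TA j gr; have := sub_TA j gl.
rewrite hv fA_vertex fB_vertex al_rot60 // => /gge0_ge0 h1 /gge0_ge0 a0.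
move=> /gge0_ge0 h3; have b0 : be (Tc j).2 (dir k) = 0 by lra.
have E := be_eq0 d0 b0; exists (al (Tc j).2 (dir k)) => //.
rewrite lt_def a0 andbT; apply: contra (dir_neq0 k) => /eqP h.
by rewrite E h scale0r.
Qed.

Lemma T_corner_ex j : exists k, vtx k = (Tc j).1.
Proof.
have d0 := Tc_neq0 j; set Q := (Tc j).1; set D := (Tc j).2.
have [[j' hj]|[k hk]|[k [hB hBe hBf hA hG]]] := germ_cases Q D (rot60 D).
- move: hj; case: (ord3_cases j j') => ->; rewrite ?Tc_succ.
  + by rewrite fB_vertex be_rot60 // be_id al_id // /gpos; intuition lra.
  + by rewrite fB_turn // fA_vertex fB_vertex /gpos; intuition lra.
  rewrite fB_turn ?turn_neq0 // fA_turn // fB_turn // fA_vertex fB_vertex.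
  rewrite !be_turn ?turn_neq0 // !al_turn // be_id al_id //.
  by rewrite /gpos; intuition lra.
- have := sub_T (germ_open_in (hk (- rot60 D))) j.
  rewrite fB_vertex beN be_rot60 // be_id al_id // /gge; clear hk.
  by intuition lra.
have k0 := dir_neq0 k; move: hB hBe hBf hA hG; rewrite -/(dir k) => hB hBe.
rewrite be_rot60 // hBe addr0; set x := al _ _ => hx hA hG.
have e_eq : D = x *: dir k by exact: be_eq0.
have x0 : 0 < x.
  rewrite lt_def hx andbT; apply: contra d0 => /eqP x0.
  by rewrite -/D e_eq x0 scale0r.
have G0 : 0 < 1 - fA (cor k) Q by move: hG; rewrite /gge; intuition lra.
case: hA => [hA|[hA _]]; last first.
  by exists k; rewrite [RHS](fAB_eq _ k0) hB hA !scale0r !addr0.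
have hk : on_side k Q by split.
have hBN : be (dir k) (- D) = 0 by rewrite beN hBe oppr0.
have := sub_TA j (on_side_germ hk hBN).
by rewrite fA_vertex alN al_id // => /gge0_ge0; rewrite oppr_ge0 ler10.
Qed.

Lemma T_corner_uniq k k' j : vtx k = (Tc j).1 -> vtx k' = (Tc j).1 -> k = k'.
Proof.
move=> hv hv'; have [x x0 hx] := T_corner_dir hv.
have [y y0 hy] := T_corner_dir hv'.
apply: (@same_ray _ _ (y / x)); rewrite ?hv ?divr_gt0 //.
by rewrite hx hy scalerA divfK ?gt_eqF.
Qed.

Lemma Tc_vtx_inj j j' : (Tc j).1 = (Tc j').1 -> j = j'.
Proof.
have d0 := Tc_neq0 j; case: (ord3_cases j j') => -> //; rewrite !Tc_succ /=.
  move=> /esym/eqP; rewrite -subr_eq0 addrAC subrr add0r.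
  by rewrite (negPf d0).
rewrite -addrA [_.2 + _]addrC subrK => /esym/eqP.
by rewrite -subr_eq0 addrAC subrr add0r rot60_eq0 (negPf d0).
Qed.

Lemma T_corner_adj k k' j : vtx k = (Tc j).1 -> ~ adj k k'.
Proof.
move=> hv [hv' [z z0 hd]]; have d0 := Tc_neq0 j.
have [x x0 hx] := T_corner_dir hv.
have [|y y0 hy] := @T_corner_dir k' j; first by rewrite -hv'.
have : be (Tc j).2 (dir k') = z * x.
  by rewrite hd hx rot60Z !coordE be_rot60 // be_id al_id // addr0 mulr1.
by rewrite hy beZ be_id mulr0 => /eqP; rewrite lt_eqF ?mulr_gt0.
Qed.

Lemma T_corner_no_pred k j : vtx k = (Tc j).1 -> ~ exists k', adj k' k.
Proof.
by move=> hv [k' h]; apply: (@T_corner_adj k' k j) => //; rewrite h.1.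
Qed.

Lemma T_corner_next_no_succ k j : vtx k = (Tc j).1 ->
  ~ exists k', adj (nxt k) k'.
Proof.
move=> hv [g [hg [z z0 hd]]]; have d0 := Tc_neq0 j.
have [x x0 hx] := T_corner_dir hv.
have {}hd : dir g = - (z * x) *: (Tc j).2.
  rewrite hd dir_nxt rot60D rot60N rot60_rot60 addrAC subrr sub0r hx.
  by rewrite scalerN scalerA scaleNr.
have := sub_T (germ_open_in (germ_own_left g)) j.
rewrite -hg vtx_nxt hv fBD fB_vertex hx beZ be_id mulr0 addr0 hd rot60Z beZ.
rewrite be_rot60 // be_id al_id // addr0 mulr1.
by move=> /gge0_ge0; rewrite oppr_ge0 leNgt mulr_gt0.
Qed.

Lemma T_corner_prev k j (z := nxt (nxt k)) : vtx k = (Tc j).1 ->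
  exists2 x, dir k = x *: (Tc j).2 &
    [/\ 0 < x, vtx z = (Tc j).1 + x *: rot60 (Tc j).2 & dir z = - rot60 (dir
      k)].
Proof.
move=> hv; have [x x0 hx] := T_corner_dir hv; exists x => //.
rewrite /z !vtx_nxt hv !dir_nxt rot60D rot60N rot60_rot60; split=> //.
  by rewrite addrACA subrr addr0 hx rot60Z.
by rewrite opprB [_ - _ - rot60 _]addrAC subrr sub0r addKr.
Qed.

Lemma T_corner_prev_no_pred k j : vtx k = (Tc j).1 ->
  ~ exists k', adj k' (nxt (nxt k)).
Proof.
move=> hv [g [hg [y y0 hd]]]; have d0 := Tc_neq0 j.
have [x hx [x0 hvz hdz]] := T_corner_prev hv.
have {}hd : dir g = - (y^-1 * x) *: (Tc j).2.
  apply: rot60_inj; rewrite scaleNr rot60N -scalerA -hx rot60Z -scalerN -hdz hd.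
  by rewrite scalerA mulVf ?scale1r ?gt_eqF.
have := sub_TA j (germ_open_in (germ_own g)).
rewrite hg hvz fAD fA_vertex alZ al_rot60 // be_id oppr0 mulr0 addr0 hd.
rewrite alZ al_id // mulr1.
by move=> /gge0_ge0; rewrite oppr_ge0 leNgt mulr_gt0 ?invr_gt0.
Qed.

(** The left side of a tile in a corner of the large triangle is another side
    with no flush end, because it stops before the next vertex. *)
Lemma T_corner_prev_not_vertex k : vtx k = (Tc 0).1 ->
  ~ Tvertex (vtx (nxt (nxt k))).
Proof.
have d0 := T_neq0; move=> hv; have [x hx [x0 -> _]] := T_corner_prev hv.
have x1 := smaller hx; clear hv hx; case=> j /(congr1 (fB T));
  rewrite fBD fB_vertex add0r.
rewrite beZ be_rot60 // be_id al_id // addr0 mulr1.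
case: (ord3_cases 0 j) => ->; rewrite ?Tc_succ ?fBD ?fB_vertex /=.
- by move=> h; lra.
- by rewrite be_id => h; lra.
by rewrite beD beN be_rot60 // be_id al_id // => h; lra.
Qed.

Lemma nxt_inj : injective nxt.
Proof. exact: (can_inj (g := nxt \o nxt) nxtK). Qed.

Lemma no_tiling : False.
Proof.
have [top htop] := choice T_corner_ex.
have topE k : k \in codom top <-> Tvertex (vtx k).
  split=> [/codomP[j ->]|[j hj]]; first by exists j.
  by apply/codomP; exists j; apply: T_corner_uniq (htop j).
apply: (@no_corner_count _ adj nxt top (nxt (nxt (top 0)))).
- exact: nxt_inj.
- exact: adj_injl.
- exact: adj_injr.
- by move=> k /negP hk; apply: adj_chain => /topE.
- exact: no_adj_prev.
- by move=> j j' e; apply: Tc_vtx_inj; rewrite -!htop e.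
- by apply/negP => /topE; apply: T_corner_prev_not_vertex.
move=> k; rewrite inE => /orP[/eqP ->|/codomP[j ->]]; last first.
  by split; [apply: T_corner_no_pred|apply: T_corner_next_no_succ].
split; first exact: T_corner_prev_no_pred (htop 0).
by rewrite nxtK => -[k']; apply: T_corner_adj (htop 0).
Qed.

End Tiling.

(** * From labelled triangles to corners *)

Section Reduction.
Variable R : realType.
Local Notation V := 'rV[R]_2.
Implicit Types (t : triangle R) (p d : V).

Definition sqnorm d : R := d 0 0 ^+ 2 + d 0 1 ^+ 2.

Lemma sum3 (M : nmodType) (F : 'I_3 -> M) :
  \sum_i F i = F (inord 0) + F (inord 1) + F (inord 2).
Proof.
rewrite !big_ord_recr big_ord0 /= add0r.
by congr (F _ + F _ + F _); apply: val_inj; rewrite /= inordK.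
Qed.

Lemma eucl_distE (p q : V) : eucl_dist p q = Num.sqrt (sqnorm (p - q)).
Proof.
rewrite /eucl_dist /sqnorm; congr Num.sqrt.
rewrite !big_ord_recr big_ord0 /= add0r !mxE.
by congr ((p 0 _ - q 0 _) ^+ 2 + (p 0 _ - q 0 _) ^+ 2); apply: val_inj.
Qed.

Lemma sqnorm_ge0 d : 0 <= sqnorm d.
Proof. by rewrite addr_ge0 ?sqr_ge0. Qed.

Lemma sqnormN d : sqnorm (- d) = sqnorm d.
Proof. by rewrite /sqnorm !mxE !sqrrN. Qed.

Lemma sqnorm_rot60 d : sqnorm (rot60 d) = sqnorm d.
Proof.
by rewrite /sqnorm rot60_0 rot60_1; field: (sqr_sqrt3 R).
Qed.

Lemma sqnormZ x d : sqnorm (x *: d) = x ^+ 2 * sqnorm d.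
Proof. by rewrite /sqnorm !mxE; ring. Qed.

(** The norms determine the dot product, hence the square of the cross product;
    the two signs of the latter are the two orientations. *)
Lemma equilateral_rot u w : sqnorm u = sqnorm w -> sqnorm (u - w) = sqnorm u ->
  u != 0 -> w = rot60 u \/ u = rot60 w.
Proof.
move=> nw nuw u0; have N0 : sqnorm u != 0.
  apply: contra u0; rewrite paddr_eq0 ?sqr_ge0 // !sqrf_eq0.
  by move=> /andP[/eqP a /eqP b]; apply/eqP/row2P; rewrite !mxE.
pose dot (x y : V) : R := x 0 0 * y 0 0 + x 0 1 * y 0 1.
have rotP (x y : V) : sqnorm x != 0 -> dot x y = sqnorm x / 2 ->
    cross x y = Num.sqrt 3 / 2 * sqnorm x -> y = rot60 x.
  rewrite /dot /cross => n0 hd hc; apply: row2P; apply: (mulfI n0).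
    rewrite rot60_0; transitivity (x 0 0 * (x 0 0 * y 0 0 + x 0 1 * y 0 1)
      - x 0 1 * (x 0 0 * y 0 1 - x 0 1 * y 0 0)); first by rewrite /sqnorm;
        ring.
    by rewrite hd hc; ring.
  rewrite rot60_1; transitivity (x 0 1 * (x 0 0 * y 0 0 + x 0 1 * y 0 1)
    + x 0 0 * (x 0 0 * y 0 1 - x 0 1 * y 0 0)); first by rewrite /sqnorm; ring.
  by rewrite hd hc; ring.
have hd : dot u w = sqnorm u / 2.
  have : sqnorm (u - w) = sqnorm u + sqnorm w - 2 * dot u w.
    by rewrite /sqnorm /dot !mxE; ring.
  by rewrite nuw -nw => h; lra.
have : cross u w ^+ 2 = (Num.sqrt 3 / 2 * sqnorm u) ^+ 2.
  have -> : cross u w ^+ 2 = sqnorm u * sqnorm w - dot u w ^+ 2.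
    by rewrite /cross /sqnorm /dot; ring.
  by rewrite hd -nw; field: (sqr_sqrt3 R).
move=> /eqP; rewrite eqf_sqr => /orP[] /eqP hc; first by left; apply: rotP.
right; apply: rotP; rewrite -?nw //.
  by rewrite -hd /dot; ring.
by rewrite -[RHS]opprK -hc /cross; ring.
Qed.

Lemma inord3_cases (P : 'I_3 -> Prop) :
  P (inord 0) -> P (inord 1) -> P (inord 2) -> forall i, P i.
Proof.
move=> h0 h1 h2 [[|[|[|//]]] h].
- by move: h0; congr P; apply: val_inj; rewrite /= inordK.
- by move: h1; congr P; apply: val_inj; rewrite /= inordK.
- by move: h2; congr P; apply: val_inj; rewrite /= inordK.
Qed.

Lemma fAB_unique (C : corner R) a b : C.2 != 0 ->
  let p := C.1 + (a *: C.2 + b *: rot60 C.2) in fA C p = a /\ fB C p = b.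
Proof.
move=> d0 /=; rewrite fAD fBD fA_vertex fB_vertex !coordE al_rot60 // be_rot60
  //.
by rewrite be_id al_id //; split; ring.
Qed.

(** If the labelling is clockwise, exchanging the last two vertices makes it
    counterclockwise. *)
Lemma equilateral_corner t : equilateral t -> exists C : corner R,
  [/\ C.2 != 0, forall p, solid t p <-> closed_tri C p,
      forall p, vertices t p <->
        [\/ p = C.1, p = C.1 + C.2 | p = C.1 + rot60 C.2]
    & side_length t = Num.sqrt (sqnorm C.2)].
Proof.
case: t => v fr; rewrite /equilateral /side_length /solid /vertices /= => eqt.
set i0 : 'I_3 := inord 0; set i1 : 'I_3 := inord 1; set i2 : 'I_3 := inord 2.
have d01 : i0 != i1 by rewrite -val_eqE /= !inordK.
have d02 : i0 != i2 by rewrite -val_eqE /= !inordK.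
have d12 : i1 != i2 by rewrite -val_eqE /= !inordK.
have e1 := eqt _ _ _ _ d01 d02; have e2 := eqt _ _ _ _ d12 d01.
pose u := v i1 - v i0; pose w := v i2 - v i0.
have u0 : u != 0 by apply: (free_not0 fr); rewrite inE eqxx.
have w0 : w != 0 by apply: (free_not0 fr); rewrite !inE eqxx orbT.
have v1 : v i1 = v i0 + u by rewrite addrC subrK.
have v2 : v i2 = v i0 + w by rewrite addrC subrK.
have sq a b : Num.sqrt (sqnorm a) = Num.sqrt (sqnorm b) -> sqnorm a = sqnorm b.
  by move=> /(congr1 (fun x => x ^+ 2)); rewrite !sqr_sqrtr ?sqnorm_ge0.
have nuw : sqnorm u = sqnorm w.
  apply: sq; rewrite -[in LHS]sqnormN -[in RHS]sqnormN !opprB.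
  by rewrite -!eucl_distE.
have nuw' : sqnorm (u - w) = sqnorm u.
  have -> : u - w = v i1 - v i2 by rewrite /u /w opprB addrA subrK.
  by apply: sq; rewrite -[in RHS]sqnormN opprB -!eucl_distE.
have solidE p : (exists l : 'I_3 -> R, [/\ forall i, 0 <= l i, \sum_i l i = 1
    & p = \sum_i l i *: v i]) <-> exists a b, [/\ 0 <= a, 0 <= b, 0 <= 1 - a - b
    & p = v i0 + (a *: u + b *: w)].
  split=> [[l [l0 l1 ->]]|[a [b [a0 b0 ab ->]]]].
    exists (l i1), (l i2); split=> //.
      by rewrite -l1 sum3 -/i0 -/i1 -/i2; have := l0 i0; lra.
    rewrite sum3 -/i0 -/i1 -/i2 in l1.
    have E : l i0 = 1 - l i1 - l i2 by rewrite -l1; ring.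
    rewrite sum3 -/i0 -/i1 -/i2 v1 v2 E.
    by apply: row2P; rewrite !mxE; ring.
  pose l (i : 'I_3) := if i == i0 then 1 - a - b else if i == i1 then a else b.
  have l0 : l i0 = 1 - a - b by rewrite /l eqxx.
  have l1 : l i1 = a by rewrite /l eqxx eq_sym (negPf d01).
  have l2 : l i2 = b by rewrite /l eq_sym (negPf d02) eq_sym (negPf d12).
  exists l; split.
  - by apply: inord3_cases; rewrite ?l0 ?l1 ?l2.
  - by rewrite sum3 l0 l1 l2; ring.
  by rewrite sum3 l0 l1 l2 v1 v2; apply: row2P; rewrite !mxE; ring.
have sl : eucl_dist (v i0) (v i1) = Num.sqrt (sqnorm u).
  by rewrite eucl_distE -sqnormN opprB.
case: (equilateral_rot nuw nuw' u0) => rE.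
  exists (v i0, u); split=> //= p.
    rewrite solidE; split=> [[a [b [a0 b0 ab ->]]]|[a0 b0 ab]].
      rewrite rE /closed_tri.
      by have [-> ->] := @fAB_unique (v i0, u) a b u0.
    exists (fA (v i0, u) p), (fB (v i0, u) p); split=> //.
    by rewrite rE; apply: (@fAB_eq _ (v i0, u)).
  rewrite -rE -v1 -v2; split=> [[i _ <-]|].
    by move: i; apply: inord3_cases; [constructor 1|constructor 2|constructor
      3].
  by case=> ->; [exists i0|exists i1|exists i2].
exists (v i0, w); split=> //= [p|p|]; last by rewrite -nuw; exact: sl.
  rewrite solidE; split=> [[a [b [a0 b0 ab ->]]]|[a0 b0 ab]].
    rewrite rE [a *: _ + _]addrC /closed_tri; have [-> ->] :=
      @fAB_unique (v i0, w) b a w0.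
    by split=> //; lra.
  exists (fB (v i0, w) p), (fA (v i0, w) p); split=> //; first by lra.
  by rewrite rE [X in _ + X]addrC; apply: (@fAB_eq _ (v i0, w)).
rewrite -rE -v1 -v2; split=> [[i _ <-]|].
  by move: i; apply: inord3_cases; [constructor 1|constructor 3|constructor 2].
by case=> ->; [exists i0|exists i2|exists i1].
Qed.

Lemma open_tri_interior (C : corner R) p :
  open_tri C p -> interior [set q | closed_tri C q] p.
Proof.
have ct (f : V -> R) : continuous f -> 0 < f p -> \forall q \near p, 0 <= f q.
  move=> cf f0; near=> q; apply/ltW; near: q.
  exact: (cvgr_gt _ (cf p)).
have aff (f : V -> R) a b c : f =1 (fun q => a + b * q 0 0 + c * q 0 1) ->
    continuous f.
  move=> /funext -> q; have cc i : ((fun q : V => q 0 i) @ q --> q 0 i)%classic.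
    exact: coord_continuous.
  apply: (@continuousD R R^o V (fun q => a + b * q 0 0) (fun q => c * q 0 1)).
    apply: (@continuousD R R^o V (fun=> a) (fun q => b * q 0 0)).
      exact: cst_continuous.
    by apply: (@continuousM R V (fun=> b) (fun q => q 0 0));
      [exact: cst_continuous|exact: cc].
  by apply: (@continuousM R V (fun=> c) (fun q => q 0 1));
    [exact: cst_continuous|exact: cc].
case: C => v d; rewrite /open_tri /closed_tri.
set N := cross d (rot60 d).
have hA : fA (v, d) =1 fun q => - (v 0 0 * rot60 d 0 1 - v 0 1 * rot60 d 0 0) /
  N
    + rot60 d 0 1 / N * q 0 0 + - rot60 d 0 0 / N * q 0 1.
  by move=> q; rewrite /fA /al -/N /cross !(mxE _ (fun _ _ => _ + _))
    !(mxE _ (fun _ _ => - _)) /=; ring.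
have hB : fB (v, d) =1 fun q => - (d 0 0 * v 0 1 - d 0 1 * v 0 0) / N
    + - d 0 1 / N * q 0 0 + d 0 0 / N * q 0 1.
  by move=> q; rewrite /fB /be -/N /cross !(mxE _ (fun _ _ => _ + _))
    !(mxE _ (fun _ _ => - _)) /=; ring.
have cA : continuous (fA (v, d)) by apply: aff hA.
have cB : continuous (fB (v, d)) by apply: aff hB.
case=> a0 b0 g0; rewrite /interior /=.
have nA := ct _ cA a0; have nB := ct _ cB b0.
have nG : \forall q \near p, 0 <= 1 - fA (v, d) q - fB (v, d) q.
  apply: (ct (fun q => 1 - fA (v, d) q - fB (v, d) q)) => // q.
  apply: (@continuousB R R^o V (fun q => 1 - fA (v, d) q)); last exact: cB.
  apply: (@continuousB R R^o V (fun=> 1)); last exact: cA.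
  exact: cst_continuous.
near=> q; split; near: q; [exact: nA|exact: nB|exact: nG].
Unshelve. all: by end_near.
Qed.

End Reduction.

Theorem theorem2p1 (R : realType) (T : triangle R) (hT : equilateral T) :
  ~ exists (n : nat) (t : 'I_n -> triangle R),
      [/\ forall i, equilateral (t i),
          forall i, side_length (t i) < side_length T,
          tiles t T
        & forall i j, i != j -> ~ two_common_vertices (t i) (t j)].
Proof.
move=> [n [t [eqt small_t [tcover tdisj] tvert]]].
have [C [C0 CE _ Cl]] := equilateral_corner hT.
have [c hc] := choice (fun i => equilateral_corner (eqt i)).
have c0 i : (c i).2 != 0 by case: (hc i).
have sol i p : solid (t i) p <-> closed_tri (c i) p by case: (hc i).
have vertE i p : vertices (t i) p <->
    [\/ p = (c i).1, p = (c i).1 + (c i).2 | p = (c i).1 + rot60 (c i).2].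
  by case: (hc i).
have vertI k : vertices (t k.1) (vtx c k).
  apply/vertE; case: k => i [[|[|[|//]]] h]; rewrite /vtx /=.
  - by constructor 1.
  - by constructor 2.
  by constructor 3; rewrite -addrA [(c i).2 + _]addrC subrK.
have norm_dir k : sqnorm (dir c k) = sqnorm (c k.1).2.
  case: k => i j; rewrite /dir /cor /=; elim: (nat_of_ord j) => //= m <-.
  by rewrite -rot60_rot60 !sqnorm_rot60.
apply: (@no_tiling R n c C) => //.
- move=> p; rewrite -CE tcover; split=> [[i _ /sol h]|[i /sol h]]; by exists i.
- move=> i i' p hi hi'; apply/eqP; apply/negPn/negP => ii.
  have E k : solid (t k) = [set q | closed_tri (c k) q]%classic.
    by apply/predeqP => q; exact: sol.
  have : (interior (solid (t i)) `&` interior (solid (t i')))%classic p.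
    by split; rewrite E; apply: open_tri_interior.
  by rewrite tdisj.
- move=> k x hx; rewrite ltNge; apply/negP => x1.
  have := small_t k.1; have [_ _ _ ->] := hc k.1; rewrite Cl.
  rewrite ltNge => /negP; apply; apply: ler_wsqrtr.
  by rewrite -norm_dir hx sqnormZ ler_peMl ?sqnorm_ge0 // exprn_ege1.
move=> k k' kk' e1 e2; apply: (tvert _ _ kk').
exists (vtx c k), (vtx c (nxt k)); split.
- rewrite vtx_nxt eq_sym -subr_eq0 addrAC subrr add0r.
  exact: dir_neq0.
- by split; [exact: vertI|rewrite e1; exact: (vertI (nxt k'))].
- by split; [exact: (vertI (nxt k))|rewrite e2; exact: vertI].
Qed.
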